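(* Let $a,b>0$. As $s\to\infty$, the superellipse $\mathscr{C}_s(a,b)$ approaches the rectangle $[-a,a]\times[-b,b]$, and $$L_{(\infty)}=4(a+b).$$
   Context: For $a,b,s>0$, the superellipse (Lamé curve) $\mathscr{C}_s(a,b)$ is the closed plane curve given in polar coordinates by $r=r_{a,b}(\theta)=\left(\frac{|\cos\theta|^s}{a^s}+\frac{|\sin\theta|^s}{b^s}\right)^{-1/s}$, $0\le\theta<2\pi$. Its perimeter (total arc length) is denoted $L_{(s)}$, and $L_{(\infty)}$ denotes the value of the perimeter in the limit $s\to\infty$. The rectangle is understood as a curve, i.e. as the boundary of $[-a,a]\times[-b,b]$. The word ''approaches'' is used informally, with no mode of convergence specified. *)

(* Defs.v *)
From HB Require Import structures.
From mathcomp Require Import all_boot all_order all_algebra.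
From mathcomp Require Import all_classical all_reals all_analysis.

Set Implicit Arguments.
Unset Strict Implicit.
Unset Printing Implicit Defensive.

Import Order.TTheory GRing.Theory Num.Theory.
Import numFieldNormedType.Exports.

Local Open Scope classical_set_scope.
Local Open Scope ring_scope.

(* The norm MathComp-Analysis puts on R * R is the sup norm, whence an explicit
   Euclidean distance. *)
Definition eucl_dist (R : realType) (p q : R * R) : R :=
  Num.sqrt ((p.1 - q.1) ^+ 2 + (p.2 - q.2) ^+ 2).

(* Same conventions as [variation]: the subdivision is a = t_0 < t_1 < ... < b,
   with [s] listing t_1, ..., b. *)
Definition polygonal_length (R : realType) (a b : R) (c : R -> R * R)
    (s : seq R) : R :=
  let F := c \o nth b (a :: s) in
  \sum_(0 <= n < size s) eucl_dist (F n) (F n.+1).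

Definition arc_length (R : realType) (a b : R) (c : R -> R * R) : \bar R :=
  ereal_sup [set (polygonal_length a b c s)%:E | s in itv_partition a b].

Definition hausdorff_dist (R : realType) (A B : set (R * R)) : \bar R :=
  let excess (X Y : set (R * R)) :=
    ereal_sup [set ereal_inf [set (eucl_dist p q)%:E | q in Y] | p in X] in
  Order.max (excess A B) (excess B A).

Definition boundary (T : topologicalType) (A : set T) : set T :=
  closure A `\` A°.

Definition polar_curve (R : realType) (r : R -> R) (theta : R) : R * R :=
  (r theta * cos theta, r theta * sin theta).

Definition superellipse_radius (R : realType) (a b s theta : R) : R :=
  (`|cos theta| `^ s / a `^ s + `|sin theta| `^ s / b `^ s) `^ (- s^-1).

Definition superellipse (R : realType) (a b s : R) : set (R * R) :=
  polar_curve (superellipse_radius a b s) @` `[0, 2 * pi[.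

(* Closed up at theta = 2 * pi, so that the last arc is counted in full. *)
Definition superellipse_perimeter (R : realType) (a b s : R) : \bar R :=
  arc_length 0 (2 * pi) (polar_curve (superellipse_radius a b s)).

Definition rectangle (R : realType) (a b : R) : set (R * R) :=
  boundary (`[- a, a] `*` `[- b, b]).

(* Main.v *)
(* In polar coordinates the superellipse is 1 / N_s(cos t, sin t), where
   N_s(x, y) = ((|x|/a)^s + (|y|/b)^s)^(1/s) lies between
   M(x, y) = max(|x|/a, |y|/b) and 2^(1/s) M(x, y), and the rectangle is M = 1.
   Hence p |-> p / N_s(p) maps the rectangle onto the superellipse and moves
   points by at most (a + b)(1 - 2^(-1/s)).
   For the perimeter, the abscissa x is a nondecreasing function of cos t and the
   ordinate y of sin t, so their total variations are 4a and 4b, whence the upper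
   bound 4(a + b).  The inscribed octagon with vertices (+-a, 0), (0, +-b) and
   2^(-1/s) (+-a, +-b) has length at least 2^(-1/s) 4(a + b). *)

Require Import Defs.
From HB Require Import structures.
From mathcomp Require Import all_boot all_order all_algebra.
From mathcomp Require Import all_classical all_reals all_analysis.
From mathcomp Require Import ring lra.
Import Order.TTheory GRing.Theory Num.Theory.
Import numFieldNormedType.Exports.
Local Open Scope classical_set_scope.
Local Open Scope ring_scope.

(** * The [s]-norm of a pair of nonnegative reals *)

(** The l^s norm on the nonnegative quadrant. For [s < 1] it is only a quasi-norm, so the proof
    relies on homogeneity and monotonicity alone, never on convexity. *)
Definition pnorm {R : realType} (s u v : R) : R := (u `^ s + v `^ s) `^ s^-1.

Lemma pnormM (R : realType) (s k u v : R) : 0 < s -> 0 <= k -> 0 <= u ->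
  0 <= v -> pnorm s (k * u) (k * v) = k * pnorm s u v.
Proof.
move=> s0 k0 u0 v0; rewrite /pnorm !powRM// -mulrDr powRM ?addr_ge0 ?powR_ge0//.
by rewrite -powRrM mulfV ?gt_eqF// powRr1.
Qed.

Lemma le_pnorm (R : realType) (s u u' v v' : R) : 0 < s -> 0 <= u <= u' ->
  0 <= v <= v' -> pnorm s u v <= pnorm s u' v'.
Proof.
move=> s0 /andP[u0 uu'] /andP[v0 vv'].
have u'0 := le_trans u0 uu'; have v'0 := le_trans v0 vv'.
apply: ge0_ler_powR; rewrite ?nnegrE ?addr_ge0 ?powR_ge0 ?invr_ge0 ?(ltW s0)//.
by apply: lerD; apply: ge0_ler_powR; rewrite ?nnegrE ?(ltW s0).
Qed.

Lemma pnormC (R : realType) (s u v : R) : pnorm s u v = pnorm s v u.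
Proof. by rewrite /pnorm addrC. Qed.

Lemma pnorm0r (R : realType) (s u : R) : 0 < s -> 0 <= u -> pnorm s u 0 = u.
Proof.
move=> s0 u0; rewrite /pnorm powR0 ?gt_eqF// addr0 -powRrM.
by rewrite mulfV ?gt_eqF// powRr1.
Qed.

Lemma pnormxx (R : realType) (s u : R) : 0 < s -> 0 <= u ->
  pnorm s u u = u * 2 `^ s^-1.
Proof.
by move=> s0 u0; rewrite -{1 2}[u]mulr1 pnormM// /pnorm powR1.
Qed.

Lemma pnorm_ge_max (R : realType) (s u v : R) : 0 < s -> 0 <= u -> 0 <= v ->
  Num.max u v <= pnorm s u v.
Proof.
move=> s0 u0 v0; rewrite ge_max; apply/andP; split.
  by rewrite -{1}(pnorm0r _ s u s0 u0) le_pnorm// lexx ?andbT.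
by rewrite -{1}(pnorm0r _ s v s0 v0) [leRHS]pnormC le_pnorm// lexx ?andbT.
Qed.

(** Raise both coordinates to their maximum and evaluate on the diagonal, where the factor 2^(1/s)
    arises. *)
Lemma pnorm_le_max (R : realType) (s u v : R) : 0 < s -> 0 <= u -> 0 <= v ->
  pnorm s u v <= Num.max u v * 2 `^ s^-1.
Proof.
move=> s0 u0 v0; rewrite -pnormxx ?le_max ?u0//.
by apply: le_pnorm => //; rewrite ?u0 ?v0 le_max lexx ?orbT.
Qed.

(** * The gauge of the superellipse *)

(** The function N_s: positively homogeneous, with the superellipse as its level set 1. *)
Definition gauge {R : realType} (a b s x y : R) : R :=
  pnorm s (`|x| / a) (`|y| / b).

Lemma gaugeC (R : realType) (a b s x y : R) : gauge a b s x y = gauge b a s y x.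
Proof. exact: pnormC. Qed.

Lemma gaugeM (R : realType) (a b s k x y : R) : 0 < a -> 0 < b -> 0 < s ->
  gauge a b s (k * x) (k * y) = `|k| * gauge a b s x y.
Proof.
move=> a0 b0 s0; rewrite /gauge !normrM -!mulrA pnormM//.
- by rewrite divr_ge0// ltW.
- by rewrite divr_ge0// ltW.
Qed.

Lemma gaugeNl (R : realType) (a b s x y : R) :
  gauge a b s (- x) y = gauge a b s x y.
Proof. by rewrite /gauge normrN. Qed.

Lemma gaugeNr (R : realType) (a b s x y : R) :
  gauge a b s x (- y) = gauge a b s x y.
Proof. by rewrite /gauge normrN. Qed.

Lemma le_gauge (R : realType) (a b s x y x' y' : R) : 0 < a -> 0 < b ->
  0 < s -> `|x| <= `|x'| -> `|y| <= `|y'| ->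
  gauge a b s x y <= gauge a b s x' y'.
Proof.
move=> a0 b0 s0 xx' yy'; apply: le_pnorm => //.
  by rewrite divr_ge0 ?(ltW a0)//= ler_pM2r ?invr_gt0.
by rewrite divr_ge0 ?(ltW b0)//= ler_pM2r ?invr_gt0.
Qed.

Lemma gauge_gt0 (R : realType) (a b s x y : R) : 0 < a -> 0 < b -> 0 < s ->
  (x != 0) || (y != 0) -> 0 < gauge a b s x y.
Proof.
move=> a0 b0 s0 xy.
apply: lt_le_trans (pnorm_ge_max _ _ _ _ s0 _ _); last 2 first.
- by rewrite divr_ge0// ltW.
- by rewrite divr_ge0// ltW.
by rewrite lt_max; apply/orP; case/orP: xy => xy; [left|right];
  rewrite divr_gt0 ?normr_gt0.
Qed.

Lemma gauge_axis (R : realType) (a b s x : R) : 0 < a -> 0 < s ->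
  gauge a b s x 0 = `|x| / a.
Proof.
by move=> a0 s0; rewrite /gauge normr0 mul0r pnorm0r// divr_ge0// ltW.
Qed.

Lemma gauge_corner (R : realType) (a b s : R) : 0 < a -> 0 < b -> 0 < s ->
  gauge a b s a b = 2 `^ s^-1.
Proof.
move=> a0 b0 s0; rewrite /gauge !gtr0_norm// !divff ?gt_eqF//.
by rewrite pnormxx// mul1r.
Qed.

Lemma cos_sin_neq0 (R : realType) (t : R) : (cos t != 0) || (sin t != 0).
Proof.
rewrite -negb_and; apply/negP => /andP[/eqP c0 /eqP s0].
by have := cos2Dsin2 t; rewrite c0 s0 expr0n addr0 => /eqP; rewrite eq_sym oner_eq0.
Qed.

Lemma superellipse_radiusE (R : realType) (a b s t : R) : 0 < a -> 0 < b ->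
  superellipse_radius a b s t = (gauge a b s (cos t) (sin t))^-1.
Proof.
have powRV (x : R) : 0 < x -> x^-1 `^ s = (x `^ s)^-1.
  by move=> x0; rewrite -powR_inv1 ?ltW// -powRrM mulN1r powRN.
move=> a0 b0; rewrite /superellipse_radius /gauge /pnorm powRN.
by rewrite !powRM // ?invr_ge0 ?ltW// !powRV.
Qed.

Lemma polar_superellipseE (R : realType) (a b s t : R) : 0 < a -> 0 < b ->
  polar_curve (superellipse_radius a b s) t =
  (cos t / gauge a b s (cos t) (sin t), sin t / gauge a b s (cos t) (sin t)).
Proof.
by move=> a0 b0; rewrite /polar_curve superellipse_radiusE// ![_^-1 * _]mulrC.
Qed.

(** * Euclidean and Hausdorff distances *)

Lemma eucl_distC (R : realType) (p q : R * R) : eucl_dist p q = eucl_dist q p.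
Proof. by rewrite /eucl_dist -(sqrrN (p.1 - _)) -(sqrrN (p.2 - _)) !opprB. Qed.

Lemma eucl_dist_le (R : realType) (p q : R * R) :
  eucl_dist p q <= `|p.1 - q.1| + `|p.2 - q.2|.
Proof.
have l0 : 0 <= `|p.1 - q.1| + `|p.2 - q.2| by rewrite addr_ge0.
rewrite -(ger0_norm l0) -(sqrtr_sqr (_ + _)) ler_sqrt ?sqr_ge0//.
rewrite [leRHS]sqrrD !real_normK ?num_real// -addrA [_ *+ 2 + _]addrC addrA lerDl.
by rewrite mulrn_wge0// mulr_ge0.
Qed.

Lemma eucl_dist_ge1 (R : realType) (p q : R * R) :
  `|p.1 - q.1| <= eucl_dist p q.
Proof. by rewrite -sqrtr_sqr ler_sqrt ?addr_ge0 ?sqr_ge0// lerDl sqr_ge0. Qed.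

Lemma eucl_dist_ge2 (R : realType) (p q : R * R) :
  `|p.2 - q.2| <= eucl_dist p q.
Proof. by rewrite -sqrtr_sqr ler_sqrt ?addr_ge0 ?sqr_ge0// lerDr sqr_ge0. Qed.

Lemma eucl_dist_ge0 (R : realType) (p q : R * R) : 0 <= eucl_dist p q.
Proof. exact: sqrtr_ge0. Qed.

(** A point of [A] keeps the first supremum from being the empty one, which is -oo. *)
Lemma hausdorff_dist_ge0 (R : realType) (A B : set (R * R)) : A !=set0 ->
  (0 <= hausdorff_dist A B)%E.
Proof.
move=> [p Ap]; rewrite /hausdorff_dist le_max; apply/orP; left.
apply: le_trans (ereal_sup_ubound _); last by exists p.
by apply: le_ereal_inf_tmp => _ [q _ <-]; rewrite lee_fin eucl_dist_ge0.
Qed.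

Lemma hausdorff_dist_le (R : realType) (A B : set (R * R)) (e : R) :
  (forall p, A p -> exists2 q, B q & eucl_dist p q <= e) ->
  (forall q, B q -> exists2 p, A p & eucl_dist p q <= e) ->
  (hausdorff_dist A B <= e%:E)%E.
Proof.
move=> AB BA; rewrite /hausdorff_dist ge_max; apply/andP; split.
  apply: ge_ereal_sup => _ [p /AB[q Bq pq] <-].
  by apply: (@le_trans _ _ (eucl_dist p q)%:E) => //; apply: ereal_inf_lbound; exists q.
apply: ge_ereal_sup => _ [q /BA[p Ap pq] <-].
by apply: (@le_trans _ _ (eucl_dist p q)%:E) => //; apply: ereal_inf_lbound; exists p;
  rewrite // eucl_distC.
Qed.

(** * The rectangle as a topological boundary *)

Lemma closure_setX (T U : topologicalType) (A : set T) (B : set U) :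
  closed A -> closed B -> closure (A `*` B) = A `*` B.
Proof.
move=> cA cB; apply/esym/closure_id; rewrite /setX.
have -> : [set z | A z.1 /\ B z.2] = (fst @^-1` A) `&` (snd @^-1` B) by [].
by apply: closedI; apply: preimage_closed => // x _; [exact: cvg_fst | exact: cvg_snd].
Qed.

Lemma interior_setX (T U : topologicalType) (A : set T) (B : set U) :
  (A `*` B)° = A° `*` B°.
Proof.
apply/seteqP; split => -[x y] /=.
  case=> -[P Q] /= [Px Qy] PQ; split.
    by apply: filterS Px => z Pz; have [] := PQ (z, y) (conj Pz (nbhs_singleton Qy)).
  by apply: filterS Qy => z Qz; have [] := PQ (x, z) (conj (nbhs_singleton Px) Qz).
by move=> [Ax By]; exists (A, B).
Qed.

(** Closed box minus open box: both bounds hold, and at least one is not strict. *)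
Lemma rectangleP (R : realType) (a b : R) (p : R * R) : 0 < a -> 0 < b ->
  rectangle a b p <-> Num.max (`|p.1| / a) (`|p.2| / b) = 1.
Proof.
move=> a0 b0; rewrite /rectangle /boundary interior_setX closure_setX; last 2 first.
- exact: itv_closed.
- exact: itv_closed.
rewrite !interior_itv /setD /= !in_itv /= -!ler_norml -!ltr_norml.
split => [[[pa pb] /not_andP pab]|pab].
  apply/eqP; rewrite eq_le ge_max le_max !ler_pdivrMr// !ler_pdivlMr// !mul1r pa pb /=.
  by case: pab => /negP; rewrite -leNgt => ->; rewrite ?orbT.
have := lexx (1 : R); rewrite -{1}pab ge_max !ler_pdivrMr// !mul1r => /andP[pa pb].
split=> // -[pa' pb']; have := ltxx (1 : R).
by rewrite -{1}pab gt_max !ltr_pdivrMr// !mul1r pa' pb'.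
Qed.

(** * Radial correspondence between rectangle and superellipse *)

Lemma polar_coordinates (R : realType) (x y : R) :
  exists2 t, t \in `[0, 2 * pi[ &
    x = Num.sqrt (x ^+ 2 + y ^+ 2) * cos t /\
    y = Num.sqrt (x ^+ 2 + y ^+ 2) * sin t.
Proof.
set r := Num.sqrt _.
have r2 : r ^+ 2 = x ^+ 2 + y ^+ 2 by rewrite sqr_sqrtr// addr_ge0 ?sqr_ge0.
have [r0|rn0] := eqVneq r 0.
  move: r2; rewrite r0 expr0n /= => /esym/eqP.
  rewrite paddr_eq0 ?sqr_ge0// !sqrf_eq0 => /andP[/eqP -> /eqP ->].
  by exists 0; rewrite ?mul0r// in_itv /= lexx mulr_gt0 ?pi_gt0.
have rp : 0 < r by rewrite lt_neqAle eq_sym rn0 sqrtr_ge0.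
have xr : -1 <= x / r <= 1.
  rewrite -ler_norml normrM normfV (gtr0_norm rp) ler_pdivrMr// mul1r.
  by rewrite -sqrtr_sqr ler_sqrt ?addr_ge0 ?sqr_ge0// lerDl sqr_ge0.
have s2 : Num.sqrt (1 - (x / r) ^+ 2) = `|y| / r.
  have -> : 1 - (x / r) ^+ 2 = (y / r) ^+ 2.
    by rewrite !expr_div_n r2; field; rewrite -r2 expf_neq0.
  by rewrite sqrtr_sqr normrM normfV (gtr0_norm rp).
have xrI : x / r \in `[(-1), 1] by rewrite in_itv.
have [y0|y0] := leP 0 y.
  exists (acos (x / r)).
    rewrite in_itv /= acos_ge0//= (le_lt_trans (acos_lepi _))//.
    by rewrite mulr_natl mulr2n ltrDl pi_gt0.
  by rewrite acosK// sin_acos// s2 ger0_norm//; split; rewrite mulrC divfK.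
(* In the open lower half-plane the angle is 2 pi - acos(x/r). Strictness here makes the arccosine
   positive, so the angle stays below the excluded endpoint 2 pi. *)
have x1 : x / r < 1.
  rewrite ltr_pdivrMr// mul1r; apply: le_lt_trans (ler_norm _) _.
  have y2 : 0 < y ^+ 2 by rewrite exprn_even_gt0//= lt_eqF.
  by rewrite -sqrtr_sqr ltr_sqrt ?ltrDl// ltr_wpDl ?sqr_ge0.
exists (2 * pi - acos (x / r)).
  rewrite in_itv /= subr_ge0 ltrBlDr ltrDl acos_gt0 ?andbT; last by case/andP: xr => ->.
  by rewrite (le_trans (acos_lepi xr))// mulr_natl mulr2n lerDl pi_ge0.
rewrite mulr_natl addrC cosD2pi sinD2pi cosN sinN acosK// sin_acos// s2.
by rewrite ltr0_norm// mulNr opprK; split; rewrite mulrC divfK.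
Qed.

Lemma max_box_bound (R : realType) (a b : R) (p : R * R) : 0 < a -> 0 < b ->
  Num.max (`|p.1| / a) (`|p.2| / b) = 1 -> `|p.1| <= a /\ `|p.2| <= b.
Proof.
move=> a0 b0 pab; have := lexx (1 : R).
by rewrite -{1}pab ge_max !ler_pdivrMr// !mul1r => /andP[].
Qed.

(** With [p] in polar form, homogeneity cancels its modulus and leaves the curve point at the same
    angle. *)
Lemma superellipse_normalize (R : realType) (a b s : R) (p : R * R) :
  0 < a -> 0 < b -> 0 < s -> (p.1 != 0) || (p.2 != 0) ->
  superellipse a b s (p.1 / gauge a b s p.1 p.2, p.2 / gauge a b s p.1 p.2).
Proof.
move: p => [x y] a0 b0 s0 /= xy.
have [t tI [xt yt]] := polar_coordinates _ x y.
exists t; first exact: tI.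
rewrite (polar_superellipseE _ _ _ _ _ a0 b0).
have r0 : 0 < Num.sqrt (x ^+ 2 + y ^+ 2).
  rewrite sqrtr_gt0; case/orP: xy => n0.
    by rewrite ltr_pwDl ?sqr_ge0// exprn_even_gt0.
  by rewrite ltr_wpDl ?sqr_ge0// exprn_even_gt0.
move: (Num.sqrt _) r0 xt yt => r r0 -> ->.
have g0 := gauge_gt0 _ a b s _ _ a0 b0 s0 (cos_sin_neq0 _ t).
rewrite gaugeM// gtr0_norm//; move: (gauge _ _ _ _ _) g0 => g g0.
by congr pair; field; rewrite !gt_eqF.
Qed.

Lemma superellipse_denormalize (R : realType) (a b s : R) (q : R * R) :
  0 < a -> 0 < b -> 0 < s -> superellipse a b s q ->
  exists2 p, rectangle a b p &
    q = (p.1 / gauge a b s p.1 p.2, p.2 / gauge a b s p.1 p.2).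
Proof.
move=> a0 b0 s0 [t _ <-]; rewrite (polar_superellipseE _ _ _ _ _ a0 b0).
(* Dividing the unit vector at angle [t] by [m] puts it on the rectangle, on the ray of [q]. *)
pose m := Num.max (`|cos t| / a) (`|sin t| / b).
have m0 : 0 < m.
  rewrite lt_max; apply/orP; case/orP: (cos_sin_neq0 _ t) => n0; [left|right];
  by rewrite divr_gt0 ?normr_gt0.
exists (m^-1 * cos t, m^-1 * sin t).
  apply/rectangleP => //=; rewrite !normrM gtr0_norm ?invr_gt0// -!mulrA.
  by rewrite -maxr_pMr ?invr_ge0 ?(ltW m0)// mulVf ?gt_eqF.
rewrite /= gaugeM// gtr0_norm ?invr_gt0//.
have g0 := gauge_gt0 _ a b s _ _ a0 b0 s0 (cos_sin_neq0 _ t).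
move: (gauge _ _ _ _ _) g0 => g g0.
by congr pair; field; rewrite !gt_eqF.
Qed.

(** On the rectangle the maximum is 1, so the gauge [g] lies in [1, 2^(1/s)]. Each coordinate moves
    by its absolute value times 1 - 1/g, and these absolute values are at most [a] and [b]. *)
Lemma eucl_dist_normalize (R : realType) (a b s : R) (p : R * R) :
  0 < a -> 0 < b -> 0 < s -> rectangle a b p ->
  eucl_dist (p.1 / gauge a b s p.1 p.2, p.2 / gauge a b s p.1 p.2) p <=
  (a + b) * (1 - 2 `^ (- s^-1)).
Proof.
move=> a0 b0 s0 /(rectangleP _ _ _ _ a0 b0) pab.
have [pa pb] := max_box_bound _ _ _ _ a0 b0 pab.
have u0 : 0 <= `|p.1| / a by rewrite divr_ge0// ltW.
have v0 : 0 <= `|p.2| / b by rewrite divr_ge0// ltW.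
have := pnorm_le_max _ _ _ _ s0 u0 v0; have := pnorm_ge_max _ _ _ _ s0 u0 v0.
rewrite pab mul1r -/(gauge a b s p.1 p.2); move: (gauge _ _ _ _ _) => g g1 g2.
have g0 : 0 < g by rewrite (lt_le_trans _ g1).
have gV1 : g^-1 <= 1 by rewrite invf_le1.
have gV2 : 2 `^ (- s^-1) <= g^-1 by rewrite powRN lef_pV2 ?posrE ?powR_gt0.
have H (x : R) : `|x / g - x| = `|x| * (1 - g^-1).
  have -> : x / g - x = - (x * (1 - g^-1)) by ring.
  by rewrite normrN normrM (@ger0_norm _ (1 - _)) ?subr_ge0.
apply: le_trans (eucl_dist_le _ _ _) _; rewrite /= !H -mulrDl.
apply: ler_pM; [exact: addr_ge0|by rewrite subr_ge0|exact: lerD|].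
by rewrite lerD2l lerN2.
Qed.

Lemma superellipse_hausdorff (R : realType) (a b s : R) :
  0 < a -> 0 < b -> 0 < s ->
  (0 <= hausdorff_dist (superellipse a b s) (rectangle a b) <=
   ((a + b) * (1 - 2 `^ (- s^-1)))%:E)%E.
Proof.
move=> a0 b0 s0; apply/andP; split.
  apply: hausdorff_dist_ge0.
  exists (polar_curve (superellipse_radius a b s) 0); exists 0 => //.
  by rewrite /= in_itv /= lexx mulr_gt0 ?pi_gt0.
apply: hausdorff_dist_le => [q|p pab].
  move=> /(superellipse_denormalize _ _ _ _ _ a0 b0 s0)[p pab ->].
  by exists p => //; exact: eucl_dist_normalize.
exists (p.1 / gauge a b s p.1 p.2, p.2 / gauge a b s p.1 p.2); last first.
  exact: eucl_dist_normalize.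
apply: superellipse_normalize => //.
(* The origin is off the rectangle: its maximum would be 0 instead of 1. *)
move/(rectangleP _ _ _ _ a0 b0): pab; rewrite -negb_and; apply: contra_eqN.
by move=> /andP[/eqP -> /eqP ->]; rewrite !normr0 !mul0r maxxx eq_sym oner_eq0.
Qed.

(** * Arc length and total variation *)

Lemma nonincreasing_total_variation (R : realType) (a b : R) (f : R -> R) :
  a <= b -> {in `[a, b] &, nonincreasing_fun f} ->
  total_variation a b f = (f a - f b)%:E.
Proof.
move=> ab fab; rewrite -total_variationN nondecreasing_total_variation//.
  by rewrite opprK addrC.
by move=> x y xab yab xy; rewrite lerN2 fab.
Qed.

Lemma polygonal_length_le_variation (R : realType) (a b : R) (c : R -> R * R)
    (s : seq R) :
  polygonal_length a b c s <=
  variation a b (fst \o c) s + variation a b (snd \o c) s.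
Proof.
rewrite /variation -big_split /=; apply: ler_sum => i _.
by rewrite eucl_distC; exact: eucl_dist_le.
Qed.

(** Every polygonal length splits into two coordinate variations, each below its own supremum. *)
Lemma arc_length_le_total_variation (R : realType) (a b : R) (c : R -> R * R) :
  (arc_length a b c <=
   total_variation a b (fst \o c) + total_variation a b (snd \o c))%E.
Proof.
apply: ge_ereal_sup => _ [s sab <-].
apply: (@le_trans _ _ (variation a b (fst \o c) s + variation a b (snd \o c) s)%:E).
  by rewrite lee_fin polygonal_length_le_variation.
by rewrite EFinD; apply: leeD; apply: ereal_sup_ubound;
  (eexists; [exact: variations_variation sab|]).
Qed.

(** * Monotonicity and total variation of the coordinates *)

Lemma ler_cos_0pi (R : realType) (x y : R) : x \in `[0, pi] -> y \in `[0, pi] ->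
  x <= y -> cos y <= cos x.
Proof.
by move=> x0 y0; rewrite le_eqVlt => /predU1P[->//|xy]; rewrite ltW// ltr_cos.
Qed.

(* Along the unit circle |d| decreases when |c| increases, so for c' <= c of the
   same sign homogeneity reduces the claim to
   N(c' c, c' d) <= N(c c', c d'). *)
Lemma gauge_ratio_le (R : realType) (a b s c d c' d' : R) :
  0 < a -> 0 < b -> 0 < s ->
  c ^+ 2 + d ^+ 2 = 1 -> c' ^+ 2 + d' ^+ 2 = 1 -> c' <= c ->
  c' / gauge a b s c' d' <= c / gauge a b s c d.
Proof.
move=> a0 b0 s0.
have g0 (x y : R) : x ^+ 2 + y ^+ 2 = 1 -> 0 < gauge a b s x y.
  move=> xy; apply: gauge_gt0 => //; rewrite -negb_and; apply/negP => /andP[/eqP x0 /eqP y0].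
  by move/eqP: xy; rewrite x0 y0 expr0n addr0 eq_sym oner_eq0.
have H (x y x' y' : R) : x ^+ 2 + y ^+ 2 = 1 -> x' ^+ 2 + y' ^+ 2 = 1 ->
    0 <= x' -> x' <= x -> x' / gauge a b s x' y' <= x / gauge a b s x y.
  move=> xy xy' x'0 xx'; have x0 := le_trans x'0 xx'.
  have cross : x' * gauge a b s x y <= x * gauge a b s x' y'.
    have := gaugeM _ a b s x' x y a0 b0 s0; rewrite (ger0_norm x'0) => <-.
    have := gaugeM _ a b s x x' y' a0 b0 s0; rewrite (ger0_norm x0) => <-.
    apply: le_gauge => //; first by rewrite mulrC.
    rewrite !normrM (ger0_norm x0) (ger0_norm x'0); apply: ler_pM => //.
    rewrite -ler_sqr ?nnegrE// !real_normK ?num_real//.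
    have : x' ^+ 2 <= x ^+ 2 by rewrite ler_sqr ?nnegrE.
    lra.
  move: (g0 _ _ xy) (g0 _ _ xy') cross.
  move: (gauge _ _ _ x y) (gauge _ _ _ x' y') => G G' G0 G'0 cross.
  by rewrite ler_pdivrMr// mulrAC ler_pdivlMr.
move=> cd cd' cc'.
have [c'0|c'0] := leP 0 c'; first exact: H.
(* If [c'] is negative and [c] is not, 0 separates the quotients. If both are negative, reflection
   in the vertical axis keeps the gauge and reverses the order. *)
have [c0|c0] := leP 0 c.
  apply: (@le_trans _ _ 0); first by rewrite nmulr_rle0// invr_ge0 ltW ?g0.
  by rewrite divr_ge0// ltW ?g0.
have := H (- c') d' (- c) d; rewrite !gaugeNl !mulNr !lerN2; apply=> //.
- by rewrite sqrrN.
- by rewrite sqrrN.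
- by rewrite oppr_ge0 ltW.
Qed.

(** The abscissa follows the cosine: it falls from [a] to [- a] on [0, pi], then climbs back on
    [pi, 2 pi]. *)
Lemma superellipse_abscissa_total_variation (R : realType) (a b s : R) :
  0 < a -> 0 < b -> 0 < s ->
  total_variation 0 (2 * pi) (fst \o polar_curve (superellipse_radius a b s)) =
  (4 * a)%:E.
Proof.
move=> a0 b0 s0; set f := _ \o _.
have fE t : f t = cos t / gauge a b s (cos t) (sin t).
  exact: (congr1 fst (polar_superellipseE _ a b s t a0 b0)).
have mono x y : cos x <= cos y -> f x <= f y.
  by move=> xy; rewrite !fE gauge_ratio_le// cos2Dsin2.
have pi0 := pi_gt0 R.
have f0 : f 0 = a.
  by rewrite fE cos0 sin0 gauge_axis// normr1 !mul1r invrK.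
have fpi : f pi = - a.
  by rewrite fE cospi sinpi gauge_axis// normrN1 mul1r mulN1r invrK.
have f2pi : f (2 * pi) = a.
  by rewrite fE mulr_natl cos2pi sin2pi gauge_axis// normr1 !mul1r invrK.
rewrite (@total_variationD _ _ _ pi); [|lra|lra].
rewrite nonincreasing_total_variation; [|lra|]; last first.
  by move=> x y xI yI xy; apply/mono/ler_cos_0pi.
rewrite nondecreasing_total_variation; [|lra|]; last first.
  move=> x y; rewrite !in_itv /= => /andP[? ?] /andP[? ?] xy; apply: mono.
  rewrite -(subrK pi x) -(subrK pi y) !cosDpi lerN2.
  by apply: ler_cos_0pi; rewrite ?in_itv /=; lra.
by rewrite -EFinD f0 fpi f2pi; congr EFin; ring.
Qed.

(** The ordinate follows the sine through 0, [b], [- b], 0, with turns at pi/2 and 3 pi/2,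
    contributing b + 2b + b. *)
Lemma superellipse_ordinate_total_variation (R : realType) (a b s : R) :
  0 < a -> 0 < b -> 0 < s ->
  total_variation 0 (2 * pi) (snd \o polar_curve (superellipse_radius a b s)) =
  (4 * b)%:E.
Proof.
move=> a0 b0 s0; set f := _ \o _.
(* Exchanging the axes puts the ordinate in the form treated by [gauge_ratio_le]. *)
have fE t : f t = sin t / gauge b a s (sin t) (cos t).
  by rewrite gaugeC; exact: (congr1 snd (polar_superellipseE _ a b s t a0 b0)).
have mono x y : sin x <= sin y -> f x <= f y.
  by move=> xy; rewrite !fE gauge_ratio_le// addrC cos2Dsin2.
have pi0 := pi_gt0 R.
have f0 : f 0 = 0 by rewrite fE sin0 mul0r.
have f2pi : f (2 * pi) = 0 by rewrite fE mulr_natl sin2pi mul0r.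
have fp : f (pi / 2) = b.
  by rewrite fE cos_pihalf sin_pihalf gauge_axis// normr1 !mul1r invrK.
have fm : f (pi + pi / 2) = - b.
  rewrite fE [pi + _]addrC cosDpi sinDpi cos_pihalf sin_pihalf oppr0.
  by rewrite gauge_axis// normrN1 mul1r mulN1r invrK.
rewrite (@total_variationD _ _ _ (pi / 2)); [|lra|lra].
rewrite (@total_variationD _ (pi / 2) _ (pi + pi / 2)); [|lra|lra].
rewrite nondecreasing_total_variation; [|lra|]; last first.
  move=> x y; rewrite !in_itv /= => /andP[? ?] /andP[? ?] xy; apply: mono.
  (* On each of the three intervals the sine is written as plus or minus a cosine whose shifted
     argument lies in [0, pi]. *)
  rewrite -[sin x]opprK -[sin y]opprK -!cosDpihalf lerN2.
  by apply: ler_cos_0pi; rewrite ?in_itv /=; lra.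
rewrite nonincreasing_total_variation; [|lra|]; last first.
  move=> x y; rewrite !in_itv /= => /andP[? ?] /andP[? ?] xy; apply: mono.
  rewrite -!cosBpihalf.
  by apply: ler_cos_0pi; rewrite ?in_itv /=; lra.
rewrite nondecreasing_total_variation; [|lra|]; last first.
  move=> x y; rewrite !in_itv /= => /andP[? ?] /andP[? ?] xy; apply: mono.
  rewrite -!cosBpihalf -(subrK pi (x - _)) -(subrK pi (y - _)) !cosDpi lerN2.
  by apply: ler_cos_0pi; rewrite ?in_itv /=; lra.
by rewrite -!EFinD f0 fp fm f2pi; congr EFin; ring.
Qed.

(** * Two-sided bounds on the perimeter *)

Lemma superellipse_perimeter_le (R : realType) (a b s : R) :
  0 < a -> 0 < b -> 0 < s -> (superellipse_perimeter a b s <= (4 * (a + b))%:E)%E.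
Proof.
move=> a0 b0 s0; rewrite mulrDr EFinD.
rewrite -(superellipse_abscissa_total_variation _ a b s)//.
rewrite -(superellipse_ordinate_total_variation _ a b s)//.
exact: arc_length_le_total_variation.
Qed.

Lemma superellipse_perimeter_ge (R : realType) (a b s : R) :
  0 < a -> 0 < b -> 0 < s ->
  ((4 * (a + b) * 2 `^ (- s^-1))%:E <= superellipse_perimeter a b s)%E.
Proof.
move=> a0 b0 s0; rewrite /superellipse_perimeter.
set c := polar_curve _; set k := 2 `^ _.
have pi0 := pi_gt0 R.
have k0 : 0 < k by rewrite powR_gt0.
(* The direction of the corner (a, b): the unit vector at [t] is (cos t / a) times (a, b), and the
   corner has gauge 2^(1/s) = 1/k, so the curve passes through (k a, k b). *)
pose t := atan (b / a).
have t1 : t < pi / 2 by exact: atan_ltpi2.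
have t0 : 0 < t by rewrite -[ltLHS]atan0 lt_atan// divr_gt0.
have ct0 : 0 < cos t by rewrite cos_gt0_pihalf//; lra.
have cE u : c u = (cos u / gauge a b s (cos u) (sin u),
                   sin u / gauge a b s (cos u) (sin u)).
  exact: polar_superellipseE.
have stE : sin t = cos t / a * b.
  have ctn0 : cos t != 0 by rewrite gt_eqF.
  have : tan t = b / a by exact: atanK.
  by rewrite /tan => /(canRL (divfK ctn0)) ->; ring.
have gt : gauge a b s (cos t) (sin t) = cos t / a / k.
  have an0 : a != 0 by rewrite gt_eqF.
  rewrite stE -{1}(divfK an0 (cos t)) gaugeM// gauge_corner//.
  by rewrite gtr0_norm ?divr_gt0// /k powRN invrK.
have xt : cos t / (cos t / a / k) = a * k by field; rewrite !gt_eqF.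
have yt : sin t / (cos t / a / k) = b * k by rewrite stE; field; rewrite !gt_eqF.
have c0 : c 0 = (a, 0).
  by rewrite cE cos0 sin0 gauge_axis// normr1 mul0r !mul1r invrK.
have c1 : c t = (a * k, b * k) by rewrite cE gt xt yt.
have c2 : c (pi / 2) = (0, b).
  rewrite cE cos_pihalf sin_pihalf gaugeC gauge_axis//.
  by rewrite normr1 mul0r !mul1r invrK.
(* Central symmetry yields the lower vertices from the upper ones. *)
have cpi u : c (u + pi) = (- (c u).1, - (c u).2).
  by rewrite !cE cosDpi sinDpi gaugeNl gaugeNr !mulNr.
have c3 : c (pi - t) = (- (a * k), b * k).
  rewrite [pi - t]addrC cE cosDpi sinDpi cosN sinN opprK gaugeNl gt.
  by rewrite mulNr xt yt.
have c4 : c pi = (- a, 0) by rewrite -[pi]add0r cpi c0 /= oppr0.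
have c5 : c (t + pi) = (- (a * k), - (b * k)) by rewrite cpi c1.
have c6 : c (pi / 2 + pi) = (0, - b) by rewrite cpi c2 /= oppr0.
have c7 : c (pi - t + pi) = (a * k, - (b * k)) by rewrite cpi c3 /= opprK.
have c8 : c (2 * pi) = (a, 0).
  by rewrite mulr_natl mulr2n cpi c4 /= opprK oppr0.
apply: le_ereal_sup_tmp.
exists (polygonal_length 0 (2 * pi) c [:: t; pi / 2; pi - t; pi; t + pi;
  pi / 2 + pi; pi - t + pi; 2 * pi])%:E.
  eexists; last by [].
  by split => //=; rewrite andbT; repeat (apply/andP; split); lra.
rewrite lee_fin /polygonal_length /= !big_nat_recr//= big_geq//.
rewrite c0 c1 c2 c3 c4 c5 c6 c7 c8.
(* Each octagon edge is bounded below by one coordinate difference: k b for the four edges ending on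
   the horizontal axis, k a for the four ending on the vertical one. [eucl_distC] restores the
   direction of travel where the positive difference runs against it. *)
have ex (x y x' y' : R) : x - x' <= eucl_dist (x, y) (x', y').
  exact: le_trans (ler_norm _) (eucl_dist_ge1 _ (x, y) (x', y')).
have ey (x y x' y' : R) : y - y' <= eucl_dist (x, y) (x', y').
  exact: le_trans (ler_norm _) (eucl_dist_ge2 _ (x, y) (x', y')).
have := ey (a * k) (b * k) a 0; rewrite eucl_distC.
have := ex (a * k) (b * k) 0 b.
have := ex 0 b (- (a * k)) (b * k).
have := ey (- (a * k)) (b * k) (- a) 0.
have := ey (- a) 0 (- (a * k)) (- (b * k)).
have := ex 0 (- b) (- (a * k)) (- (b * k)); rewrite eucl_distC.
have := ex (a * k) (- (b * k)) 0 (- b); rewrite eucl_distC.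
have := ey a 0 (a * k) (- (b * k)); rewrite eucl_distC.
lra.
Qed.

(** * Passage to the limit *)

(** The power is exp(-(1/s) ln c), with 1/s tending to 0 and exp continuous. *)
Lemma cvg_powR_oppV (R : realType) (c : R) : 0 < c ->
  c `^ (- s^-1) @[s --> +oo] --> (1 : R).
Proof.
move=> c0; rewrite /powR gt_eqF//.
have -> : (1 : R) = expR (- 0 * ln c) by rewrite oppr0 mul0r expR0.
apply: (continuous_cvg _ (@continuous_expR R _)).
apply: cvgMr_tmp; apply: cvgN; apply: (iffRL (gtr0_cvgV0 _)); last exact: cvg_id.
exact: nbhs_pinfty_gt.
Qed.

Theorem proposition5p5 (R : realType) (a b : R) (ha : 0 < a) (hb : 0 < b) :
  (hausdorff_dist (superellipse a b s) (rectangle a b) @[s --> +oo] --> 0%E) /\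
  (superellipse_perimeter a b s @[s --> +oo] --> (4 * (a + b))%:E).
Proof.
have k1 := cvg_powR_oppV R 2 (ltr0Sn _ _).
split.
  (* Both limits follow by squeezing, since the bounds hold for all positive [s], hence
     eventually. *)
  apply: (@squeeze_cvge _ _ _ _ (cst 0%E) _
    (fun s => ((a + b) * (1 - 2 `^ (- s^-1)))%:E)).
  - by near=> s; exact: superellipse_hausdorff.
  - exact: cvg_cst.
  - apply: cvg_EFin; first exact: nearW.
    rewrite [X in _ --> X](_ : _ = (a + b) * (1 - 1)); last by rewrite subrr mulr0.
    by apply: cvgMl_tmp; apply: cvgB => //; exact: cvg_cst.
apply: (@squeeze_cvge _ _ _ _ (fun s => (4 * (a + b) * 2 `^ (- s^-1))%:E) _
  (cst (4 * (a + b))%:E)).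
- by near=> s; rewrite superellipse_perimeter_ge//= superellipse_perimeter_le.
- apply: cvg_EFin; first exact: nearW.
  rewrite -[X in _ --> X]mulr1; exact: cvgMl_tmp.
- exact: cvg_cst.
Unshelve. all: end_near.
Qed.
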